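(* Let $P(\vec{d} : \vec{D}) = \sum_{i \in I} \sum_{e_i : E_i} c_i \rightarrow \alpha_i \,.\, P(\vec{g}_i)$ be an LPE and let $(V, K^V, J^V, c^V, \alpha^V, h^V)$ and $(W, K^W, J^W, c^W, \alpha^W, h^W)$ be separation tuples for $P$ forming a cleave of $P$, with induced LPEs $P_V$ and $P_W$. Let $\psi$ be a state invariant of $P$ and let $C = J^V \cap J^W$. Let $P^{\psi,C}_V$ (resp. $P^{\psi,C}_W$) be the LPE obtained from $P_V$ (resp. $P_W$) by replacing, for every $i \in C$, the condition $c^V_i$ (resp. $c^W_i$) of the $i$-indexed summand by $c^V_i \wedge \psi$ (resp. $c^W_i \wedge \psi$), leaving all other summands unchanged (and renaming the recursive calls accordingly). Then for every closed expression $\vec{\iota} : \vec{D}$ such that $[\![[\vec d \gets \vec\iota](\psi)]\!]$ is true, the LTS of $$\tau_{\{\mathsf{tag}\}}\Big(\nabla_{\{\underline{\alpha_i} \mid i \in I\} \cup \{\underline{\alpha_i|\mathsf{tag}} \mid i \in K^V \cup K^W\}}\Big(\tau_{\{\mathsf{sync}^i \mid i \in I\}}\Big(\Gamma_{\{\mathsf{sync}^i_V | \mathsf{sync}^i_W \rightarrow \mathsf{sync}^i \mid i \in I\}}\big(P^{\psi,C}_V(\vec{\iota}|_V) \parallel P^{\psi,C}_W(\vec{\iota}|_W)\big)\Big)\Big)\Big)$$ is strongly bisimilar to $[\![P(\vec\iota)]\!]$, i.e. it is a valid decomposition of $P$ and $\vec\iota$.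
   Context: Data: an abstract data theory of sorts with non-empty semantic domains; expressions, free variables $\mathsf{FV}(e)$, closed expressions (no free variables). A substitution $\sigma$ is a total map from variables to closed expressions of the same sort; $\sigma(e)$ is syntactic replacement; $[x \gets t]$ denotes the substitution replacing $x$ by $t$; $[\![e]\!]$ is the value of closed $e$; ''$[\![\sigma(c)]\!]$'' for a Boolean $c$ means it evaluates to true. Vectors: $\vec{d} = \langle d_0,\dots,d_n\rangle$; for $U \subseteq \mathbb{N}$, $\vec{d}|_U$ is the subvector of entries with indices in $U$; $\{\vec d\}$ is the set of entries; $U^c = \mathbb{N} \setminus U$. Actions: $\Lambda$ is a set of action labels, label $a$ with data sort $D_a$. $\Omega$ is the set of finite multi-sets over $\{a(v) \mid a \in \Lambda, v \in \mathbb{D}_a\}$. Multi-action expressions $\alpha ::= \tau \mid a(f) \mid \alpha|\alpha$; $[\![\tau]\!]_\sigma$ is empty, $[\![a(f)]\!]_\sigma = \{a([\![\sigma(f)]\!])\}$, $[\![\alpha|\beta]\!]_\sigma = [\![\alpha]\!]_\sigma + [\![\beta]\!]_\sigma$; $[\![\sigma(\alpha)]\!]$ means $[\![\alpha]\!]_\sigma$. $\underline{\alpha}$ is the multi-set of labels of $\alpha$; likewise $\underline{\omega}$ for $\omega\in\Omega$. LPE: an equation $P(\vec d : \vec D) = \sum_{i \in I} \sum_{e_i : E_i} c_i \rightarrow \alpha_i \,.\, P(\vec g_i)$, $I$ finite, sum variable $e_i$ of sort $E_i$, Boolean condition $c_i$, multi-action $\alpha_i$, update $\vec g_i$ of sort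 $\vec D$, all with free variables among $\{\vec d\} \cup \{e_i\}$. Semantics of $P(\vec\iota)$: states are symbols $P(\vec\iota')$ for closed $\vec\iota'$; for every $i$ and substitution $\sigma$ with $\sigma(\vec d) = \vec\iota'$ and $[\![\sigma(c_i)]\!]$ true there is a transition $P(\vec\iota') \xrightarrow{[\![\sigma(\alpha_i)]\!]} P(\sigma(\vec g_i))$. State invariant: a Boolean expression $\psi$ with $\mathsf{FV}(\psi) \subseteq \{\vec d\}$ such that for all $i \in I$ and closed $\vec\iota : \vec D$, $l : E_i$: if $[\![[\vec d \gets \vec\iota, e_i \gets l](c_i \wedge \psi)]\!]$ is true then $[\![[\vec d \gets [\vec d \gets \vec\iota, e_i \gets l](\vec g_i)](\psi)]\!]$ is true. Process algebra: $S ::= \Gamma_C(S) \mid \nabla_A(S) \mid \tau_H(S) \mid S \parallel S \mid P(\iota)$, $C$ a finite set of communications $a_0|\dots|a_n \rightarrow c$ (left-hand sides share no labels; a right-hand label occurs in no other left-hand side), $A$ a finite set of multi-sets of labels, $H$ a finite set of labels. Rules: if $P \xrightarrow{\omega} P'$ then $\Gamma_C(P) \xrightarrow{\gamma_C(\omega)} \Gamma_C(P')$, $\nabla_A(P) \xrightarrow{\omega} \nabla_A(P')$ provided $\underline{\omega} \in A$, $\tau_H(P) \xrightarrow{\theta_H(\omega)} \tau_H(P')$, and $P \parallel Q \xrightarrow{\omega} P' \parallel Q$; symmetrically for $Q$; and if $P \xrightarrow{\omega} P'$, $Q \xrightarrow{\omega'} Q'$ then $P \parallel Q \xrightarrow{\omega+\omega'}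 P' \parallel Q'$. $\theta_H(\omega)$ removes all elements $a(v)$ with $a \in H$; $\gamma_C$ applies every communication in $C$, where $a_0|\dots|a_n \rightarrow c$ repeatedly replaces a sub-multi-set $\{a_0(v),\dots,a_n(v)\}$ (same value $v$) by $c(v)$ while one exists. Strong bisimilarity of LTSs is standard. Separation tuple for $P$: $(U, K, J, c^U, \alpha^U, h^U)$ with $U \subseteq \mathbb{N}$, $K \subseteq J \subseteq I$, and families $c^U_i$ (Boolean), $\alpha^U_i$ (multi-action), $\vec h^U_i$ (data vector) for $i \in J\setminus K$, such that for $i \in J\setminus K$ their free variables lie in $\{\vec d\} \cup \{e_i\}$, and for $i \in K$, $\mathsf{FV}(c_i) \cup \mathsf{FV}(\alpha_i) \cup \mathsf{FV}(\vec g_i|_U) \subseteq \{\vec d|_U\} \cup \{e_i\}$. Induced LPE: $$P_U(\vec d|_U : \vec D|_U) = \sum_{i \in J\setminus K} \sum_{e_i : E_i,\ \vec d|_{U^c} : \vec D|_{U^c}} c^U_i \rightarrow \alpha^U_i | \mathsf{sync}^i_U(\vec h^U_i) \,.\, P_U(\vec g_i|_U) + \sum_{i \in K} \sum_{e_i : E_i} c_i \rightarrow \alpha_i|\mathsf{tag} \,.\, P_U(\vec g_i|_U),$$ with fresh labels $\mathsf{sync}^i_U$, $\mathsf{tag}$ (and $\mathsf{sync}^i$ also fresh). Note that for $i \in C$, $\psi$'s free variables are bound by the summand's sum over $\vec d|_{U^c}$ together with the parameters $\vec d|_U$. Cleave: the two tuples form a cleave iff (1) $J^V = I \setminus K^W$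 and $J^W = I \setminus K^V$; (2) $\vec g_r|_W = \vec d|_W$ for $r \in K^V$ and $\vec g_r|_V = \vec d|_V$ for $r \in K^W$; (3) for all $r \in J^V\cap J^W$ and $\sigma$ with $[\![\sigma(c_r)]\!]$ true: $[\![\sigma(c^V_r)]\!]$, $[\![\sigma(c^W_r)]\!]$ true, $[\![\sigma(\vec h^V_r)]\!] = [\![\sigma(\vec h^W_r)]\!]$, $[\![\sigma(\alpha^V_r|\alpha^W_r)]\!] = [\![\sigma(\alpha_r)]\!]$; (4) for all $r \in J^V\cap J^W$ and $\sigma, \sigma'$ with $[\![\sigma(c^V_r)]\!]$, $[\![\sigma'(c^W_r)]\!]$ true and $[\![\sigma(\vec h^V_r)]\!] = [\![\sigma'(\vec h^W_r)]\!]$, there is $\rho$ with $[\![\rho(\vec d|_V)]\!] = [\![\sigma(\vec d|_V)]\!]$, $[\![\rho(\vec d|_W)]\!] = [\![\sigma'(\vec d|_W)]\!]$, $[\![\rho(c_r)]\!]$ true, $[\![\sigma(\alpha^V_r)|\sigma'(\alpha^W_r)]\!] = [\![\rho(\alpha_r)]\!]$, $[\![\sigma(\vec g_r|_V)]\!] = [\![\rho(\vec g_r|_V)]\!]$, $[\![\sigma'(\vec g_r|_W)]\!] = [\![\rho(\vec g_r|_W)]\!]$.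
   Formalization: The formal theorem additionally assumes that every parameter index lies in V or W; without this the claim is false (V = W = ∅ with summand d_0 → a.P(d_0), c^V = c^W = true lets the composition do a while P(false) deadlocks). *)

(* Defs.v *)
From mathcomp Require Import all_boot finmap multiset.

Set Implicit Arguments.
Unset Strict Implicit.
Unset Printing Implicit Defensive.

Local Open Scope fset_scope.
Local Open Scope mset_scope.

Definition closed_of (V : choiceType) (E : Type) (fv : E -> {fset V}) :=
  {e : E | fv e == fset0}.

(* An abstract data theory.  [app sigma e] is the closed expression sigma(e) and
   [eval e] the value of the closed expression e.  [closed_dflt] is what makes
   total substitutions exist; together with [eval] it also makes every semantic
   domain non-empty.  Domains are choice types only so that multi-sets of
   actions can be formed; classically every type is one.  [eval_app] is the
   compositionality of the interpretation. *)
Record data_theory := DataTheory {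
  dsort : choiceType;
  dom : dsort -> choiceType;
  var : choiceType;
  vsort : var -> dsort;
  expr : dsort -> Type;
  fv : forall s, expr s -> {fset var};
  evar : forall x, expr (vsort x);
  closed_dflt : forall s, closed_of (@fv s);
  app : (forall x, closed_of (@fv (vsort x))) ->
        forall s, expr s -> closed_of (@fv s);
  eval : forall s, closed_of (@fv s) -> dom s;
  fv_evar : forall x, fv (evar x) = [fset x];
  app_evar : forall sigma x, app sigma (evar x) = sigma x;
  app_closed : forall sigma s (e : closed_of (@fv s)), app sigma (sval e) = e;
  app_ext : forall sigma sigma' s (e : expr s),
    (forall x, x \in fv e -> sigma x = sigma' x) ->
    app sigma e = app sigma' e;
  eval_app : forall sigma sigma' s (e : expr s),
    (forall x, x \in fv e -> eval (sigma x) = eval (sigma' x)) ->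
    eval (app sigma e) = eval (app sigma' e);
  bsort : dsort;
  is_tt : dom bsort -> bool;
  is_tt_bij : bijective is_tt;
  eand : expr bsort -> expr bsort -> expr bsort;
  fv_eand : forall b c, fv (eand b c) = (fv b `|` fv c)%fset;
  eval_eand : forall sigma b c,
    is_tt (eval (app sigma (eand b c))) =
    is_tt (eval (app sigma b)) && is_tt (eval (app sigma c))
}.

Section Processes.

Variable T : data_theory.

Definition closed s := closed_of (@fv T s).
Definition subst := forall x : var T, closed (vsort x).

Definition holds (sigma : subst) (b : expr (bsort T)) : bool :=
  is_tt (eval (app sigma b)).

(* Vectors of closed expressions for a finite family of variables x. *)
Definition vec (K : finType) (x : K -> var T) := forall k, closed (vsort (x k)).

(* sigma[x <- t].  The families used below consist of pairwise distinct
   variables, so that the order of the replacements is irrelevant. *)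
Definition bind (K : finType) (x : K -> var T) (t : vec x) (sigma : subst) :
    subst :=
  foldr (fun k (rho : subst) => dfwith rho (t k)) sigma (enum K).

Definition dflt_subst : subst := fun x => closed_dflt (vsort x).

(* [x <- t]; only applied to expressions whose free variables are among x, so
   that the values of [dflt_subst] do not matter. *)
Definition subst1 (K : finType) (x : K -> var T) (t : vec x) : subst :=
  bind t dflt_subst.

(* [x <- t, y <- u] *)
Definition subst2 (K : finType) (x : K -> var T) (t : vec x)
    (K' : finType) (y : K' -> var T) (u : vec y) : subst :=
  bind u (bind t dflt_subst).

(* Sorted expressions and values: data arguments of actions are finite vectors
   of these.  The empty vector is the argument of labels without data. *)
Definition sexpr := {s : dsort T & expr s}.
Definition value := {s : dsort T & dom s}.

Definition args_fv (f : seq sexpr) : {fset var T} :=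
  foldr (fun e A => (fv (tagged e) `|` A)%fset) fset0 f.

Definition args_eval (sigma : subst) (f : seq sexpr) : seq value :=
  [seq Tagged (@dom T) (eval (app sigma (tagged e))) | e <- f].

Variable L : choiceType.
Variable D : L -> seq (dsort T).

Definition action := (L * seq value)%type.
Local Notation Omega := {mset action}.

Definition labels (w : Omega) : {mset L} := seq_mset [seq a.1 | a <- w].

Inductive mact := Tau | Act (a : L) (f : seq sexpr) | Bar (alpha beta : mact).

Fixpoint mact_eval (sigma : subst) (alpha : mact) : Omega :=
  match alpha with
  | Tau => mset0
  | Act a f => [mset (a, args_eval sigma f)]
  | Bar alpha beta => mact_eval sigma alpha `+` mact_eval sigma beta
  end.

Fixpoint mact_fv (alpha : mact) : {fset var T} :=
  match alpha with
  | Tau => fset0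
  | Act _ f => args_fv f
  | Bar alpha beta => (mact_fv alpha `|` mact_fv beta)%fset
  end.

Fixpoint mact_labels (alpha : mact) : {mset L} :=
  match alpha with
  | Tau => mset0
  | Act a _ => [mset a]
  | Bar alpha beta => mact_labels alpha `+` mact_labels beta
  end.

Fixpoint mact_sorted (alpha : mact) : bool :=
  match alpha with
  | Tau => true
  | Act a f => [seq tag e | e <- f] == D a
  | Bar alpha beta => mact_sorted alpha && mact_sorted beta
  end.

(* The summand  sum_(e : E) cond -> act . P(next)  of an LPE with parameters d.
   The sum variables e form a finite family: induced LPEs sum over several
   variables at once. *)
Record summand (K : finType) (d : K -> var T) := Summand {
  sm_idx : finType;
  sm_var : sm_idx -> var T;
  sm_cond : expr (bsort T);
  sm_act : mact;
  sm_next : forall k, expr (vsort (d k))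
}.

Record lpe (K : finType) := Lpe {
  prm : K -> var T;
  idx : finType;
  smd : idx -> summand prm
}.

Definition cond K (P : lpe K) (i : idx P) := sm_cond (smd i).
Definition act K (P : lpe K) (i : idx P) := sm_act (smd i).
Definition next K (P : lpe K) (i : idx P) := sm_next (smd i).
Definition svar K (P : lpe K) (i : idx P) := @sm_var _ _ (smd i).
Arguments svar {K P} i _.
Arguments next {K P} i k.
Arguments sm_idx {K d} s.

(* The variables {d|_U} + {e_i}. *)
Definition scope_vars K (P : lpe K) (U : pred K) (i : idx P) : pred (var T) :=
  [pred x | [exists k, U k && (prm P k == x)] || (x \in codom (svar i))].

Definition lpe_wf K (P : lpe K) : Prop :=
  injective (prm P) /\
  forall i : idx P,
    [/\ injective (svar i),
        forall k l, prm P k != svar i l,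
        mact_sorted (act i) &
        [/\ {subset fv (cond i) <= scope_vars predT i},
            {subset mact_fv (act i) <= scope_vars predT i} &
            forall k, {subset fv (next i k) <= scope_vars predT i}]].

Definition lpe_step K (P : lpe K) (t : vec (prm P)) (w : Omega)
    (t' : vec (prm P)) : Prop :=
  exists (i : idx P) (sigma : subst),
    [/\ forall k, sigma (prm P k) = t k,
        holds sigma (cond i),
        w = mact_eval sigma (act i) &
        forall k, t' k = app sigma (next i k)].

Definition state_invariant K (P : lpe K) (psi : expr (bsort T)) : Prop :=
  {subset fv psi <= codom (prm P)} /\
  forall (i : idx P) (t : vec (prm P)) (l : vec (svar i)),
    holds (subst2 t l) (eand (cond i) psi) ->
    holds (@subst1 _ (prm P) (fun k => app (subst2 t l) (next i k))) psi.

Record lts := Lts {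
  state : Type;
  step : state -> Omega -> state -> Prop;
  init : state
}.

Definition bisimilar (M N : lts) : Prop :=
  exists R : state M -> state N -> Prop,
    R (init M) (init N) /\
    forall s t, R s t ->
      (forall w s', step s w s' -> exists2 t', step t w t' & R s' t') /\
      (forall w t', step t w t' -> exists2 s', step s w s' & R s' t').

Definition lpe_lts K (P : lpe K) (t : vec (prm P)) : lts :=
  Lts (@lpe_step K P) t.

(* A communication a_0|...|a_n -> c: the multi-set of labels on the left and
   the label on the right. *)
Definition comm := ({mset L} * L)%type.

(* {a_0(v), ..., a_n(v)} *)
Definition redex (a : {mset L}) (v : seq value) : Omega :=
  seq_mset [seq (x, v) | x <- a].

Fixpoint comm_iter (n : nat) (r : comm) (w : Omega) : Omega :=
  if n is m.+1 then
    if [seq a.2 | a <- w & redex r.1 a.2 `<=` w] is v :: _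
    then comm_iter m r ((w `\` redex r.1 v) `+` [mset (r.2, v)])
    else w
  else w.

(* Repeated replacement while a redex exists: each round either shrinks w or,
   for a left-hand side of one label a_0 <> c, consumes one a_0, so that size w
   rounds are enough. *)
Definition gamma1 (r : comm) (w : Omega) : Omega := comm_iter (size w) r w.

(* The order is irrelevant when the left-hand sides share no labels and no
   right-hand label occurs in another left-hand side. *)
Definition gamma (C : {fset comm}) (w : Omega) : Omega := foldr gamma1 w C.

Definition theta (H : {fset L}) (w : Omega) : Omega :=
  seq_mset [seq a <- w | a.1 \notin H].

Inductive proc : Type :=
  | PComm (C : {fset comm}) (S : proc)
  | PAllow (A : {fset {mset L}}) (S : proc)
  | PHide (H : {fset L}) (S : proc)
  | PPar (S S' : proc)
  | PCall (K : finType) (P : lpe K) (t : vec (prm P)).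

Inductive proc_step : proc -> Omega -> proc -> Prop :=
  | step_comm C S w S' :
      proc_step S w S' -> proc_step (PComm C S) (gamma C w) (PComm C S')
  | step_allow A S w S' :
      proc_step S w S' -> labels w \in A ->
      proc_step (PAllow A S) w (PAllow A S')
  | step_hide H S w S' :
      proc_step S w S' -> proc_step (PHide H S) (theta H w) (PHide H S')
  | step_parl S1 S2 w S1' :
      proc_step S1 w S1' -> proc_step (PPar S1 S2) w (PPar S1' S2)
  | step_parr S1 S2 w S2' :
      proc_step S2 w S2' -> proc_step (PPar S1 S2) w (PPar S1 S2')
  | step_par S1 S2 w1 w2 S1' S2' :
      proc_step S1 w1 S1' -> proc_step S2 w2 S2' ->
      proc_step (PPar S1 S2) (w1 `+` w2) (PPar S1' S2')
  | step_call (K : finType) (P : lpe K) (t t' : vec (prm P)) w :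
      lpe_step t w t' -> proc_step (PCall t) w (PCall t').

Definition proc_lts (S : proc) : lts := Lts proc_step S.

(* P with the condition c_i of every summand i in C replaced by c_i /\ psi. *)
Definition strengthen K (P : lpe K) (psi : expr (bsort T))
    (C : pred (idx P)) : lpe K :=
  @Lpe K (prm P) (idx P) (fun i =>
    if C i then
      @Summand K (prm P) (sm_idx (smd i)) (svar i) (eand (cond i) psi)
        (act i) (next i)
    else smd i).

Variable n : nat.

(* The families sep_c, sep_a and sep_h are only meaningful on sep_J :\: sep_K. *)
Record sep_tuple (P : lpe 'I_n.+1) := SepTuple {
  sep_U : pred nat;
  sep_K : {set idx P};
  sep_J : {set idx P};
  sep_c : idx P -> expr (bsort T);
  sep_a : idx P -> mact;
  sep_h : idx P -> seq sexpr
}.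

Definition is_sep_tuple (P : lpe 'I_n.+1) (X : sep_tuple P) : Prop :=
  [/\ sep_K X \subset sep_J X,
      forall i, i \in sep_J X :\: sep_K X ->
        [/\ mact_sorted (sep_a X i),
            {subset fv (sep_c X i) <= scope_vars predT i},
            {subset mact_fv (sep_a X i) <= scope_vars predT i} &
            {subset args_fv (sep_h X i) <= scope_vars predT i}] &
      forall i, i \in sep_K X ->
        [/\ {subset fv (cond i) <= scope_vars (fun k : 'I_n.+1 => sep_U X k) i},
            {subset mact_fv (act i) <= scope_vars (fun k : 'I_n.+1 => sep_U X k) i} &
            forall k : 'I_n.+1, sep_U X k ->
              {subset fv (next i k) <= scope_vars (fun k : 'I_n.+1 => sep_U X k) i}]].

Definition idx_in (U : pred nat) : finType := {k : 'I_n.+1 | U k}.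
Definition idx_out (U : pred nat) : finType := {k : 'I_n.+1 | ~~ U k}.

(* d|_U and t|_U *)
Definition restr_prm (d : 'I_n.+1 -> var T) (U : pred nat) :
    idx_in U -> var T := fun k => d (val k).
Definition restr (d : 'I_n.+1 -> var T) (U : pred nat) (t : vec d) :
    vec (@restr_prm d U) := fun k => t (val k).

(* The index set J of the induced LPE is the disjoint union of J \ K, whose
   summands additionally sum over the parameters outside U, and K. *)
Definition induced (P : lpe 'I_n.+1) (X : sep_tuple P) (sync : idx P -> L)
    (tg : L) : lpe (idx_in (sep_U X)) :=
  @Lpe _ (@restr_prm (prm P) (sep_U X)) {i : idx P | i \in sep_J X} (fun j =>
    let i := val j in
    if i \in sep_K X then
      @Summand _ (@restr_prm (prm P) (sep_U X))
        (sm_idx (smd i)) (svar i)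
        (cond i) (Bar (act i) (Act tg [::])) (fun k => next i (val k))
    else
      @Summand _ (@restr_prm (prm P) (sep_U X))
        (sm_idx (smd i) + idx_out (sep_U X))%type
        (fun l => match l with inl e => svar i e | inr k => prm P (val k) end)
        (sep_c X i) (Bar (sep_a X i) (Act (sync i) (sep_h X i)))
        (fun k => next i (val k))).

(* P_U^(psi, C) *)
Definition induced_psi (P : lpe 'I_n.+1) (X : sep_tuple P) (sync : idx P -> L)
    (tg : L) (psi : expr (bsort T)) (C : {set idx P}) :
    lpe (idx_in (sep_U X)) :=
  @strengthen _ (induced X sync tg) psi (fun j => val j \in C).

Definition same_value (sigma rho : subst) s (e : expr s) : Prop :=
  eval (app sigma e) = eval (app rho e).

Definition cleave (P : lpe 'I_n.+1) (X Y : sep_tuple P) : Prop :=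
  [/\ sep_J X = ~: sep_K Y /\ sep_J Y = ~: sep_K X,
      (forall r (k : 'I_n.+1), r \in sep_K X -> sep_U Y k ->
         next r k = evar (prm P k)) /\
      (forall r (k : 'I_n.+1), r \in sep_K Y -> sep_U X k ->
         next r k = evar (prm P k)),
      forall r (sigma : subst), r \in sep_J X :&: sep_J Y ->
        holds sigma (cond r) ->
        [/\ holds sigma (sep_c X r), holds sigma (sep_c Y r),
            args_eval sigma (sep_h X r) = args_eval sigma (sep_h Y r) &
            mact_eval sigma (Bar (sep_a X r) (sep_a Y r)) =
            mact_eval sigma (act r)] &
      forall r (sigma sigma' : subst), r \in sep_J X :&: sep_J Y ->
        holds sigma (sep_c X r) -> holds sigma' (sep_c Y r) ->
        args_eval sigma (sep_h X r) = args_eval sigma' (sep_h Y r) ->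
        exists rho : subst,
          [/\ forall k : 'I_n.+1, sep_U X k ->
                same_value rho sigma (evar (prm P k)),
              forall k : 'I_n.+1, sep_U Y k ->
                same_value rho sigma' (evar (prm P k)),
              holds rho (cond r),
              mact_eval sigma (sep_a X r) `+` mact_eval sigma' (sep_a Y r) =
              mact_eval rho (act r) &
              (forall k : 'I_n.+1, sep_U X k ->
                 same_value sigma rho (next r k)) /\
              (forall k : 'I_n.+1, sep_U Y k ->
                 same_value sigma' rho (next r k))]].

(* sync_V^i, sync_W^i, sync^i and tag are pairwise distinct, do not occur in P
   or in the separation tuples, and carry data of the right sorts. *)
Definition fresh_labels (P : lpe 'I_n.+1) (X Y : sep_tuple P)
    (syncV syncW sync : idx P -> L) (tg : L) : Prop :=
  let new := tg :: codom syncV ++ codom syncW ++ codom sync in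
  [/\ uniq new,
      forall a, a \in new ->
        [/\ forall i : idx P, a \notin mact_labels (act i),
            forall i, i \in sep_J X :\: sep_K X ->
              a \notin mact_labels (sep_a X i) &
            forall i, i \in sep_J Y :\: sep_K Y ->
              a \notin mact_labels (sep_a Y i)],
      D tg = [::],
      forall i, D (syncV i) = D (sync i) /\ D (syncW i) = D (sync i) &
      (forall i, i \in sep_J X :\: sep_K X ->
         [seq tag e | e <- sep_h X i] = D (syncV i)) /\
      (forall i, i \in sep_J Y :\: sep_K Y ->
         [seq tag e | e <- sep_h Y i] = D (syncW i))].

End Processes.

(* Main.v *)
Require Import Defs.
From mathcomp Require Import all_boot finmap multiset.

(* A state of the composition is related to a state t of P satisfying psi when
   the parameters of both components have the values prescribed by t: data
   enter only through values, by compositionality of evaluation.  After Gamma,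
   an unmatched sync label or a second tag makes the multi-action violate the
   allow set, so the surviving steps are exactly a tagged step of one component
   (K^V or K^W) and a synchronisation of both on a common summand i in C.  A
   tagged step leaves the other component's parameters unchanged, so P follows
   with the same summand.  For a synchronisation, condition (4) of the cleave
   provides the substitution for the step of P; conversely, condition (3)
   splits a step of P, and psi, being an invariant, holds on both sides. *)

Set Implicit Arguments.
Unset Strict Implicit.
Unset Printing Implicit Defensive.

Local Open Scope mset_scope.
Local Open Scope fset_scope.

(** * Substitutions and evaluation *)

Section Substitutions.

Variable T : data_theory.
Implicit Types (sigma rho : subst T).

Lemma bind_in (K : finType) (x : K -> var T) (t : vec x) sigma k :
  injective x -> bind t sigma (x k) = t k.
Proof.
move=> x_inj; rewrite /bind.
elim: (enum K) (mem_enum K k) => [|l s IHs] /=; first by [].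
rewrite inE; case: (eqVneq k l) => [<- _|neq_kl /= k_s].
  (* [dfwith] transports [t k] along a proof of [x k = x k]; by uniqueness of identity proofs this
     is the identity. *)
  by rewrite /dfwith; case: eqP => //= p; rewrite eq_axiomK.
by rewrite dfwith_out ?IHs// (inj_eq x_inj) eq_sym.
Qed.

Lemma bind_out (K : finType) (x : K -> var T) (t : vec x) sigma y :
  (forall k, x k != y) -> bind t sigma y = sigma y.
Proof.
by move=> xNy; rewrite /bind; elim: (enum K) => //= k s IHs; rewrite dfwith_out.
Qed.

(** Agreement is in value only: components and [P] may hold syntactically different closed
    expressions for the same data. *)
Definition agree_on (A : {pred var T}) sigma rho : Prop :=
  {in A, forall x, eval (sigma x) = eval (rho x)}.

Lemma holds_agree (A : {pred var T}) sigma rho (b : expr (bsort T)) :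
  {subset fv b <= A} -> agree_on A sigma rho -> holds sigma b = holds rho b.
Proof. by move=> sA E; congr (is_tt _); apply: eval_app => x /sA /E. Qed.

Lemma same_value_agree (A : {pred var T}) sigma rho s (e : expr s) :
  {subset fv e <= A} -> agree_on A sigma rho -> same_value sigma rho e.
Proof. by move=> sA E; apply: eval_app => x /sA /E. Qed.

Lemma args_eval_agree (A : {pred var T}) sigma rho (f : seq (sexpr T)) :
  {subset args_fv f <= A} -> agree_on A sigma rho ->
  args_eval sigma f = args_eval rho f.
Proof.
move=> + E; elim: f => //= e f IHf sA; congr (_ :: _).
  congr existT; apply: same_value_agree E => x x_e.
  by apply: sA; rewrite in_fsetU x_e.
by apply: IHf => x x_f; apply: sA; rewrite in_fsetU x_f orbT.
Qed.

Lemma mact_eval_agree (L : choiceType) (A : {pred var T}) sigma rho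
    (alpha : mact T L) :
  {subset mact_fv alpha <= A} -> agree_on A sigma rho ->
  mact_eval sigma alpha = mact_eval rho alpha.
Proof.
move=> + E; elim: alpha => [|a f|alpha IHa beta IHb] //= sA.
  by rewrite (args_eval_agree sA E).
by rewrite IHa ?IHb// => x x_ab; apply: sA; rewrite in_fsetU x_ab ?orbT.
Qed.

End Substitutions.

(** * Labels, hiding and communication on multi-sets of actions *)

Section Multisets.

Local Open Scope mset_scope.

Variables (T : data_theory) (L : choiceType).
Implicit Types (w : {mset action T L}).

Lemma labelsE w l : labels w l = count (fun a => a.1 == l) w.
Proof. by rewrite mset_seqE count_map; apply: eq_count => a. Qed.

Lemma perm_enum_msetD (K : choiceType) (A B : {mset K}) :
  perm_eq (A `+` B) (A ++ B).
Proof.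
apply/allP => x _ /=; rewrite count_cat.
by rewrite (count_mem_mset x A) (count_mem_mset x B) count_mem_mset msetE2.
Qed.

Lemma labelsD w1 w2 : labels (w1 `+` w2) = labels w1 `+` labels w2.
Proof.
apply/msetP => l; rewrite msetE2 !labelsE -count_cat.
by apply/permP/perm_enum_msetD.
Qed.

Lemma labels1 (a : action T L) : labels [mset a] = [mset a.1].
Proof.
apply/msetP => l; rewrite labelsE (enum_msetn 1 a) /= addn0 msetnE eq_sym.
by case: eqP.
Qed.

Lemma mem_labels w a : a \in w -> a.1 \in labels w.
Proof.
move=> aw; rewrite in_mset labelsE -has_count; apply/hasP.
by exists a; rewrite //=.
Qed.

Lemma labels_mact_eval (sigma : subst T) (alpha : mact T L) :
  labels (mact_eval sigma alpha) = mact_labels alpha.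
Proof.
elim: alpha => [|a f|alpha IHa beta IHb] /=.
- by apply/msetP => l; rewrite labelsE enum_mset0 mset0E.
- exact: labels1.
- by rewrite labelsD IHa IHb.
Qed.

Lemma thetaE (H : {fset L}) w a : theta H w a = if a.1 \in H then 0 else w a.
Proof.
rewrite mset_seqE count_filter -count_mem_mset; case: ifP => aH.
  by apply/eqP; rewrite -leqn0 leqNgt -has_count; apply/hasPn => b _ /=;
     case: (b =P a) => // ->; rewrite aH.
by apply: eq_count => b /=; case: eqP => // ->; rewrite aH.
Qed.

Lemma thetaD (H : {fset L}) w1 w2 :
  theta H (w1 `+` w2) = theta H w1 `+` theta H w2.
Proof.
by apply/msetP => a; rewrite thetaE !msetE2 !thetaE; case: ifP.
Qed.

Lemma theta_id (H : {fset L}) w :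
  {in labels w, forall l, l \notin H} -> theta H w = w.
Proof.
move=> wNH; apply/msetP => a; rewrite thetaE; case: ifP => // aH.
by apply/esym/mset_eq0P/negP => /mem_labels/wNH; rewrite aH.
Qed.

Lemma theta1 (H : {fset L}) (a : action T L) :
  a.1 \in H -> theta H [mset a] = mset0.
Proof.
move=> aH; apply/msetP => b; rewrite thetaE mset0E msetnE.
by case: ifP => // bH; case: eqP bH => // ->; rewrite aH.
Qed.

Lemma labels_theta (H : {fset L}) w l :
  labels (theta H w) l = if l \in H then 0 else labels w l.
Proof.
rewrite !labelsE (permP (perm_eq_seq_mset _)) count_filter; case: ifP => lH.
  by apply/eqP; rewrite -leqn0 leqNgt -has_count; apply/hasPn => b _ /=;
     case: eqP => // ->; rewrite lH.
by apply: eq_count => b /=; case: eqP => // ->; rewrite lH.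
Qed.

Lemma redexE (r : {mset L}) (v : seq (value T)) (a : action T L) :
  redex r v a = if a.2 == v then r a.1 else 0.
Proof.
rewrite mset_seqE count_map -count_mem_mset; case: eqP => [<-|neq_av].
  by apply: eq_count => x /=; case: a => a1 a2 /=; rewrite xpair_eqE eqxx andbT.
apply/eqP; rewrite -leqn0 leqNgt -has_count; apply/hasPn => x _ /=.
by apply/eqP => eq_a; apply: neq_av; rewrite -eq_a.
Qed.

Lemma comm_iter_id m (r : comm L) w :
  (forall v, ~~ (redex r.1 v `<=` w)) -> comm_iter m r w = w.
Proof.
case: m => //= m noredex; rewrite (eq_filter (a2 := pred0)) ?filter_pred0//.
by move=> a; apply/negbTE/noredex.
Qed.

(** The first round can only pick the value [v], and its result contains no redex, so all later
    rounds are idle. A non-empty left-hand side guarantees both that a first round takes place and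
    that [v] is found among the data of the elements. *)
Lemma gamma1_redex (r : comm L) w v :
  r.1 != mset0 ->
  (forall v', redex r.1 v' `<=` w `+` redex r.1 v -> v' = v) ->
  (forall v', ~~ (redex r.1 v' `<=` w `+` [mset (r.2, v)])) ->
  gamma1 r (w `+` redex r.1 v) = w `+` [mset (r.2, v)].
Proof.
move=> r0 uniq_redex noredex; rewrite /gamma1; set w' := w `+` redex r.1 v.
have [x xr] : exists x, x \in r.1.
  case s: (enum_mset r.1) => [|x s']; last first.
    by exists x; rewrite -topredE /= s mem_head.
  case/eqP: r0; apply/msetP => x; rewrite mset0E; apply/mset_eq0P.
  by rewrite -topredE /= s.
have xv_w' : (x, v) \in w'.
  by rewrite in_msetD [_ \in redex _ _]in_mset redexE eqxx mset_gt0 xr orbT.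
have redex_w' : redex r.1 v `<=` w'.
  by apply/msubsetP => a; rewrite msetE2 leq_addl.
have : size w' != 0.
  by rewrite size_eq0; apply: contraL xv_w' => /eqP s; rewrite -topredE /= s.
case: (size w') => // m _ /=.
case s: [seq _ | _ <- _ & _] => [|v0 s'].
  suff : v \in [::] by []; rewrite -s; apply/mapP; exists (x, v) => //.
  by rewrite mem_filter redex_w'.
have -> : v0 = v.
  have : v0 \in v0 :: s' by rewrite mem_head.
  rewrite -s => /mapP[a]; rewrite mem_filter => /andP[/uniq_redex a2v _] ->.
  exact: a2v.
by rewrite msetDKBC comm_iter_id.
Qed.

Lemma gamma_id (C : {fset comm L}) w :
  (forall r v, r \in C -> ~~ (redex r.1 v `<=` w)) -> gamma C w = w.
Proof.
rewrite /gamma => noredex.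
have {noredex} : forall r v, r \in (C : seq _) -> ~~ (redex r.1 v `<=` w) by [].
elim: (C : seq _) => //= r s IHs noredex.
rewrite IHs => [|r' v r's]; last by apply: noredex; rewrite inE r's orbT.
by apply: comm_iter_id => v; apply: noredex; rewrite mem_head.
Qed.

Lemma gamma_redex (C : {fset comm L}) r w v :
  r \in C -> r.1 != mset0 ->
  (forall r' v', r' \in C -> redex r'.1 v' `<=` w `+` redex r.1 v ->
     r' = r /\ v' = v) ->
  (forall r' v', r' \in C -> ~~ (redex r'.1 v' `<=` w `+` [mset (r.2, v)])) ->
  gamma C (w `+` redex r.1 v) = w `+` [mset (r.2, v)].
Proof.
move=> rC r0 uniq_redex noredex; rewrite /gamma.
have {rC}: r \in (C : seq _) by [].
have {uniq_redex}: forall r' v', r' \in (C : seq _) ->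
  redex r'.1 v' `<=` w `+` redex r.1 v -> r' = r /\ v' = v by [].
have {noredex}: forall r' v', r' \in (C : seq _) ->
  ~~ (redex r'.1 v' `<=` w `+` [mset (r.2, v)]) by [].
set w' := w `+` redex r.1 v; set w'' := w `+` _.
(* The induction runs over an arbitrary list of communications, since a tail may or may not contain
   [r]: the intermediate result is [w''] once [r] has fired and [w'] before. *)
suff key s :
  (forall r' v', r' \in s -> ~~ (redex r'.1 v' `<=` w'')) ->
  (forall r' v', r' \in s -> redex r'.1 v' `<=` w' -> r' = r /\ v' = v) ->
  foldr (@gamma1 T L) w' s = if r \in s then w'' else w'.
  by move=> n u rC; rewrite key ?rC.
elim: s => //= r' s IHs n u.
rewrite {}IHs => [|r1 v' r1s|r1 v' r1s]; last first.
- by apply: u; rewrite inE r1s orbT.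
- by apply: n; rewrite inE r1s orbT.
(* If [r] has fired in the tail, nothing in [w''] can react. Otherwise the head either is [r] and
   fires, or has no redex in [w']. *)
rewrite inE; case: (r \in s); rewrite ?orbT ?orbF.
  by apply: comm_iter_id => v'; apply: n; rewrite mem_head.
case: eqVneq => [def_r|neq_r].
  rewrite -def_r; apply: gamma1_redex => // v'.
    by move=> /u[]; rewrite ?inE ?def_r ?eqxx.
  by apply: n; rewrite def_r mem_head.
apply: comm_iter_id => v'; apply/negP => /u[]; rewrite ?mem_head// => eq_r.
by rewrite eq_r eqxx in neq_r.
Qed.

End Multisets.

(** * Inversion and construction of steps *)

Section Processes.

Variables (T : data_theory) (L : choiceType).
Implicit Types (sigma rho : subst T) (w : {mset action T L}).

(** Matching on the source process lets a plain case analysis do the inversion, with no equalities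
    between dependent pairs for calls. *)
Lemma proc_step_inv (S S' : proc T L) w :
  proc_step S w S' ->
  match S with
  | PComm C S1 =>
      exists w1 S1', [/\ proc_step S1 w1 S1', w = gamma C w1 & S' = PComm C S1']
  | PAllow A S1 =>
      exists S1', [/\ proc_step S1 w S1', labels w \in A & S' = PAllow A S1']
  | PHide H S1 =>
      exists w1 S1', [/\ proc_step S1 w1 S1', w = theta H w1 & S' = PHide H S1']
  | PPar S1 S2 =>
      [\/ exists2 S1', proc_step S1 w S1' & S' = PPar S1' S2,
          exists2 S2', proc_step S2 w S2' & S' = PPar S1 S2' |
          exists w1 w2 S1' S2', [/\ proc_step S1 w1 S1', proc_step S2 w2 S2',
            w = (w1 `+` w2)%mset & S' = PPar S1' S2']]
  | PCall K P t => exists2 t', lpe_step t w t' & S' = PCall t'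
  end.
Proof.
case.
- by move=> C S1 w1 S1' ?; exists w1, S1'.
- by move=> A S1 w1 S1' ? ?; exists S1'.
- by move=> H S1 w1 S1' ?; exists w1, S1'.
- by move=> S1 S2 w1 S1' ?; apply: Or31; exists S1'.
- by move=> S1 S2 w1 S1' ?; apply: Or32; exists S1'.
- by move=> S1 S2 w1 w2 S1' S2' ? ?; apply: Or33; exists w1, w2, S1', S2'.
- by move=> K P t t' w1 ?; exists t'.
Qed.

(** A step requires the substitution to yield the state syntactically, while only values are known
    to agree. Overwriting the parameters of [sigma] by [t] repairs this without changing any
    value. *)
Lemma lpe_step_intro (K : finType) (P : lpe T L K) (i : idx P) sigma
    (t : vec (prm P)) :
  injective (prm P) ->
  (forall k, eval (t k) = eval (sigma (prm P k))) ->
  holds sigma (cond i) ->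
  exists2 t' : vec (prm P), lpe_step t (mact_eval sigma (act i)) t' &
    forall k, eval (t' k) = eval (app sigma (Defs.next i k)).
Proof.
move=> inj_prm Et ci.
have E : agree_on predT (bind t sigma) sigma.
  move=> x _; have [/codomP[k ->]|xN] := boolP (x \in codom (prm P)).
    by rewrite bind_in ?Et.
  by rewrite bind_out// => k; apply: contraNneq xN => <-; apply: codom_f.
exists (fun k => app (bind t sigma) (Defs.next i k)); last first.
  by move=> k; apply: same_value_agree E.
exists i, (bind t sigma); split=> //.
- by move=> k; rewrite bind_in.
- by rewrite (holds_agree _ E).
- by rewrite (mact_eval_agree _ E).
Qed.

(** Overwriting parameters leaves the sum variables alone, as the two families are disjoint; so
    agreement of values on [U] suffices for a summand that reads no other parameter. *)
Lemma bind_agree_scope (D : L -> seq (dsort T)) (K : finType) (P : lpe T L K)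
    (U : pred K) (i : idx P) sigma (t : vec (prm P)) :
  lpe_wf D P -> (forall k, U k -> eval (t k) = eval (sigma (prm P k))) ->
  agree_on (scope_vars U i) (bind t sigma) sigma.
Proof.
move=> [inj_prm /(_ i)[_ disj _ _]] Et x /orP[/existsP[k /andP[Uk /eqP <-]]|].
  by rewrite bind_in ?Et.
by case/codomP=> l ->; rewrite bind_out.
Qed.

Lemma holds_subst1 (K : finType) (x : K -> var T) (t : vec x) sigma psi :
  injective x -> {subset fv psi <= codom x} ->
  (forall k, eval (sigma (x k)) = eval (t k)) ->
  holds sigma psi = holds (subst1 t) psi.
Proof.
move=> inj_x sub_psi Et; apply: holds_agree sub_psi _ => _ /codomP[k ->].
by rewrite /subst1 bind_in.
Qed.

Lemma invariant_step (D : L -> seq (dsort T)) (K : finType) (P : lpe T L K) psi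
    (t t' : vec (prm P)) w :
  lpe_wf D P -> state_invariant P psi -> lpe_step t w t' ->
  holds (subst1 t) psi -> holds (subst1 t') psi.
Proof.
move=> wfP [sub_psi inv] [i [sigma [Et ci _ Et']]] psi_t.
have [inj_prm /(_ i)[inj_svar disj _ [sub_c _ sub_n]]] := wfP.
(* The invariant quantifies over replacements, the step over substitutions: giving the sum variables
   their images under [sigma] makes both agree in value on the scope of the summand. *)
pose l : vec (svar (i:=i)) := fun k => sigma (svar k).
have E : agree_on (scope_vars predT i) (subst2 t l) sigma.
  move=> x /orP[/existsP[k /andP[_ /eqP <-]]|/codomP[k ->]]; rewrite /subst2.
    by rewrite bind_out ?bind_in ?Et// => k'; rewrite eq_sym.
  by rewrite bind_in.
have /inv : holds (subst2 t l) (eand (cond i) psi).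
  rewrite /holds eval_eand -!/(holds _ _) (holds_agree sub_c E) ci /=.
  rewrite (holds_subst1 inj_prm sub_psi (t := t))// => k.
  by rewrite /subst2 bind_out ?bind_in// => k'; rewrite eq_sym.
rewrite -(@holds_subst1 _ _ _ (subst1 t'))// => k.
by rewrite /subst1 bind_in// Et'; apply: same_value_agree (sub_n k) _ => x /E.
Qed.

End Processes.

(** * Steps of the strengthened induced LPEs *)

Section Induced.

Local Open Scope mset_scope.

Variables (T : data_theory) (L : choiceType) (D : L -> seq (dsort T)) (n : nat).
Variables (P : lpe T L 'I_n.+1) (X : sep_tuple P) (syn : idx P -> L) (tg : L).
Variables (psi : expr (bsort T)) (C : {set idx P}).
Implicit Types (sigma rho : subst T).

(** Together with [ind_act], this describes the summands of [PX] by indices of [P] instead of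
    elements of the subtype [J], hiding the dependent records from the composition argument. *)
Definition ind_cond sigma (i : idx P) : bool :=
  holds sigma (if i \in sep_K X then cond i else sep_c X i) &&
  ((i \in C) ==> holds sigma psi).

Definition ind_act sigma (i : idx P) : {mset action T L} :=
  if i \in sep_K X then mact_eval sigma (act i) `+` [mset (tg, [::])]
  else mact_eval sigma (sep_a X i) `+` [mset (syn i, args_eval sigma (sep_h X i))].

Local Notation PX := (induced_psi X syn tg psi C).

Lemma holds_induced sigma (j : idx PX) :
  holds sigma (cond j) = ind_cond sigma (val j).
Proof.
rewrite /ind_cond /cond /=; case: (val j \in C) => /=.
  by rewrite /holds eval_eand /= /cond /=; case: ifP.
by rewrite andbT; case: ifP.
Qed.

Lemma mact_eval_induced sigma (j : idx PX) :
  mact_eval sigma (act j) = ind_act sigma (val j).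
Proof.
by rewrite /ind_act /act /=; case: (val j \in C) => /=; rewrite /act /=; case: ifP.
Qed.

Lemma next_induced (j : idx PX) k : Defs.next j k = Defs.next (val j) (val k).
Proof.
by rewrite /Defs.next /=; case: (val j \in C) => /=; rewrite /Defs.next /=; case: ifP.
Qed.

Lemma induced_step_inv (t t' : vec (restr_prm (prm P) (U:=sep_U X))) w :
  @lpe_step T L _ PX t w t' ->
  exists i sigma, [/\ i \in sep_J X, forall k, sigma (prm P (val k)) = t k,
    ind_cond sigma i, w = ind_act sigma i &
    forall k, t' k = app sigma (Defs.next i (val k))].
Proof.
move=> [j [sigma [Et cj -> Et']]]; exists (val j), sigma; split=> //.
- exact: valP j.
- by rewrite -holds_induced.
- exact: mact_eval_induced.
- by move=> k; rewrite Et' next_induced.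
Qed.

Lemma induced_step_intro (t : vec (restr_prm (prm P) (U:=sep_U X))) i sigma :
  injective (prm P) -> i \in sep_J X ->
  (forall k, eval (t k) = eval (sigma (prm P (val k)))) -> ind_cond sigma i ->
  exists2 t' : vec (restr_prm (prm P) (U:=sep_U X)),
    @lpe_step T L _ PX t (ind_act sigma i) t' &
    forall k, eval (t' k) = eval (app sigma (Defs.next i (val k))).
Proof.
move=> inj_prm iJ Et ci; pose j : idx PX := Sub i iJ.
have inj_prmX : injective (prm PX) by move=> k l /inj_prm/val_inj.
have cj : holds sigma (cond j) by rewrite holds_induced.
have [t' st Et'] := lpe_step_intro inj_prmX Et cj.
exists t' => [|k]; first by rewrite mact_eval_induced in st.
by rewrite Et' next_induced.
Qed.

End Induced.

(** * Reserved labels and the communication, hiding and allow operators *)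

Section Composition.

Local Open Scope mset_scope.

Variables (T : data_theory) (L : choiceType) (D : L -> seq (dsort T)) (n : nat).
Variables (P : lpe T L 'I_n.+1) (V W : sep_tuple P).
Variables (syncV syncW sync : idx P -> L) (tg : L).
Hypothesis fresh : fresh_labels D V W syncV syncW sync tg.
Implicit Types (sigma rho : subst T) (w : {mset action T L}).

Let comms : {fset comm L} :=
  [fset ([mset syncV i; syncW i], sync i) | i in idx P].
Let syncs : {fset L} := [fset sync i | i in idx P].
Let allowed : {fset {mset L}} :=
  ([fset mact_labels (act i) | i in idx P] `|`
  [fset mact_labels (Bar (act i) (Act tg [::])) |
     i in (sep_K V :|: sep_K W)%SET])%fset.

Let new : seq L := tg :: codom syncV ++ codom syncW ++ codom sync.

Lemma new_tg : tg \in new. Proof. exact: mem_head. Qed.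

Lemma new_syncV i : syncV i \in new.
Proof. by rewrite !(inE, mem_cat) codom_f orbT. Qed.

Lemma new_syncW i : syncW i \in new.
Proof. by rewrite !(inE, mem_cat) codom_f !orbT. Qed.

Lemma new_sync i : sync i \in new.
Proof. by rewrite !(inE, mem_cat) codom_f !orbT. Qed.

Lemma new_distinct :
  [/\ injective syncV, injective syncW &
   [/\ forall i j, syncV i <> syncW j, forall i j, syncV i <> sync j &
       forall i j, syncW i <> sync j]] /\
  [/\ forall i, syncV i <> tg, forall i, syncW i <> tg & forall i, sync i <> tg].
Proof.
case: fresh => + _ _ _ _; rewrite /= !mem_cat !negb_or !cat_uniq has_cat negb_or.
case/andP=> /and3P[tgV tgW tgS] /and3P[uV /andP[VW VS] /and3P[uW WS uS]].
have notin (f : idx P -> L) a : a \notin codom f -> forall i, f i <> a.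
  by move=> + i fi; rewrite -fi codom_f.
have disj (f g : idx P -> L) : ~~ has (mem (codom f)) (codom g) ->
    forall i j, f i <> g j.
  move=> /hasPn dis i j eq_fg; have /dis := codom_f g j.
  by rewrite -eq_fg /= codom_f.
split; split; try exact: notin; try exact/injectiveP.
by split; apply: disj.
Qed.

(** Such a [w] is inert: it takes part in no communication and is untouched by both hidings. *)
Definition is_fresh w : Prop := {in new, forall a, a \notin labels w}.

Lemma mem_fresh a v w : is_fresh w -> a \in new -> ((a, v) \in w) = false.
Proof. by move=> fw /fw; apply: contraNF => /mem_labels. Qed.

Lemma fresh_act sigma (i : idx P) : is_fresh (mact_eval sigma (act i)).
Proof.
case: fresh => _ fr _ _ _ a /fr[Fa _ _]; rewrite labels_mact_eval; exact: Fa.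
Qed.

Lemma redex2P (x y : L) (v : seq (value T)) w :
  redex [mset x; y] v `<=` w -> (x, v) \in w /\ (y, v) \in w.
Proof.
by move=> /msubset_subset sub; split; apply: sub;
   rewrite in_mset redexE /= eqxx mset_gt0 in_mset2 eqxx ?orbT.
Qed.

Lemma redex2E (x y : L) (v : seq (value T)) :
  redex [mset x; y] v = [mset (x, v)] `+` [mset (y, v)].
Proof.
apply/msetP => -[z u]; rewrite redexE !msetE2 !msetnE !xpair_eqE /=.
by case: (u == v); rewrite ?andbT ?andbF.
Qed.

Lemma comms_codom r : r \in comms ->
  exists i, r = ([mset syncV i; syncW i], sync i).
Proof. by move=> /imfsetP[i _ ->]; exists i. Qed.

Lemma gamma_comms_id w :
  (forall i v, (syncV i, v) \in w -> (syncW i, v) \in w -> False) ->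
  gamma comms w = w.
Proof.
move=> noredex; apply: gamma_id => _ v /comms_codom[i ->].
by apply/negP => /redex2P[]; apply: noredex.
Qed.

(** Every redex contains some [syncV j]. The only one present is in the added pair, and none remains
    after the replacement. *)
Lemma gamma_comms_sync i v w : is_fresh w ->
  gamma comms (w `+` ([mset (syncV i, v)] `+` [mset (syncW i, v)])) =
  w `+` [mset (sync i, v)].
Proof.
move=> fw; have [[inV inW [VW VS WS]] _] := new_distinct.
rewrite -redex2E.
apply: (@gamma_redex T L comms ([mset syncV i; syncW i], sync i)).
- by apply/imfsetP; exists i.
- apply/negP => /eqP/msetP/(_ (syncV i))/eqP.
  by rewrite mset0E mset_eq0 mset21.
- move=> _ v' /comms_codom[j ->] /redex2P[] /=.
  rewrite redex2E !in_msetD (mem_fresh _ fw (new_syncV _)) !in_mset1 !xpair_eqE /=.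
  move=> /orP[/andP[/eqP/inV -> /eqP ->]//|/andP[/eqP/VW//]].
- move=> _ v' /comms_codom[j ->]; apply/negP => /redex2P[] /=.
  rewrite in_msetD (mem_fresh _ fw (new_syncV _)) in_mset1 xpair_eqE.
  by move=> /andP[/eqP/VS].
Qed.

(** These are the three obstructions by which unwanted steps are discarded: a leftover label of
    either component, or two tags. *)
Lemma allowed_new (l : {mset L}) : l \in allowed ->
  [/\ forall i, syncV i \notin l, forall i, syncW i \notin l & l tg <= 1].
Proof.
have [_ [tV tW _]] := new_distinct.
case: fresh => _ fr _ _ _; rewrite in_fsetU => /orP[]/imfsetP[i _ ->] /=.
  split=> [j|j|]; last by case: (fr _ new_tg) => /(_ i)/mset_eq0P-> _ _.
    by case: (fr _ (new_syncV j)).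
  by case: (fr _ (new_syncW j)).
split=> [j|j|].
- rewrite in_msetD in_mset1 negb_or; case: (fr _ (new_syncV j)) => -> _ _ /=.
  exact/eqP/tV.
- rewrite in_msetD in_mset1 negb_or; case: (fr _ (new_syncW j)) => -> _ _ /=.
  exact/eqP/tW.
- by rewrite msetE2 msetnxx; case: (fr _ new_tg) => /(_ i)/mset_eq0P-> _ _.
Qed.

Lemma syncs_notin : [/\ forall i, syncV i \notin syncs,
  forall i, syncW i \notin syncs & tg \notin syncs].
Proof.
have [[_ _ [_ VS WS]] [_ _ tS]] := new_distinct.
split=> [i|i|]; apply/negP => /imfsetP[j _].
- exact: VS.
- exact: WS.
- by move/esym; apply: tS.
Qed.

(** Hiding the [sync i] removes neither component labels nor tags, so the obstructions apply already
    to the multi-action before hiding. *)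
Lemma allowed_theta w : labels (theta syncs w) \in allowed ->
  [/\ forall i v, (syncV i, v) \notin w, forall i v, (syncW i, v) \notin w &
      labels w tg <= 1].
Proof.
have [sV sW st] := syncs_notin.
move=> /allowed_new[aV aW at1]; split; last first.
- by rewrite labels_theta (negbTE st) in at1.
- move=> i v; apply/negP => /mem_labels /=; apply/negP.
  by have := aW i; rewrite !in_mset labels_theta (negbTE (sW i)).
- move=> i v; apply/negP => /mem_labels /=; apply/negP.
  by have := aV i; rewrite !in_mset labels_theta (negbTE (sV i)).
Qed.

Lemma fresh_theta (H : {fset L}) w : is_fresh w -> {subset H <= new} ->
  theta H w = w.
Proof.
by move=> fw Hn; apply: theta_id => l; apply: contraL => /Hn/fw.
Qed.

Lemma syncs_new : {subset syncs <= new}.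
Proof. by move=> _ /imfsetP[i _ ->]; apply: new_sync. Qed.

Lemma tg_new : {subset [fset tg] <= new}.
Proof. by move=> a; rewrite in_fset1 => /eqP ->; apply: new_tg. Qed.

(** * Steps that pass the encapsulation *)

Definition encapsulate (S : proc T L) : proc T L :=
  PHide [fset tg] (PAllow allowed (PHide syncs (PComm comms S))).

Lemma encapsulate_step S w S' : proc_step S w S' ->
  labels (theta syncs (gamma comms w)) \in allowed ->
  proc_step (encapsulate S) (theta [fset tg] (theta syncs (gamma comms w)))
    (encapsulate S').
Proof.
by move=> st al; apply/step_hide/step_allow => //; apply/step_hide/step_comm.
Qed.

Lemma encapsulate_step_inv S w S' : proc_step (encapsulate S) w S' ->
  exists w1 S1, [/\ proc_step S w1 S1,
    labels (theta syncs (gamma comms w1)) \in allowed,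
    w = theta [fset tg] (theta syncs (gamma comms w1)) & S' = encapsulate S1].
Proof.
move=> /proc_step_inv[w1 [S1 [/proc_step_inv[S2 [st al ->]] -> ->]]].
have [w2 [S3 [/proc_step_inv[w3 [S4 [st' -> ->]]] eq1 ->]]] := proc_step_inv st.
by exists w3, S4; rewrite -eq1.
Qed.

Lemma gamma_tagged w : is_fresh w ->
  gamma comms (w `+` [mset (tg, [::])]) = w `+` [mset (tg, [::])].
Proof.
have [_ [tV _ _]] := new_distinct.
move=> fw; apply: gamma_comms_id => i v.
rewrite in_msetD (mem_fresh _ fw (new_syncV _)) in_mset1 xpair_eqE.
by move=> /andP[/eqP/tV].
Qed.

(** The tag survives communication and the inner hiding, so the labels fall in the second part of
    the allow set; the outer hiding then erases it. *)
Lemma encapsulate_tagged (i : idx P) sigma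
    (w := mact_eval sigma (act i) `+` [mset (tg, [::])]) :
  (i \in sep_K V) || (i \in sep_K W) ->
  labels (theta syncs (gamma comms w)) \in allowed /\
  theta [fset tg] (theta syncs (gamma comms w)) = mact_eval sigma (act i).
Proof.
have fw := fresh_act sigma i; have [_ _ st] := syncs_notin.
move=> iK; rewrite /w gamma_tagged// thetaD (fresh_theta fw syncs_new).
rewrite (theta_id (w := [mset _])); last first.
  by move=> l; rewrite labels1 in_mset1 => /eqP ->.
split; last first.
  by rewrite thetaD (fresh_theta fw tg_new) theta1 ?inE// msetD0.
rewrite labelsD labels1 labels_mact_eval in_fsetU; apply/orP; right.
by apply/imfsetP; exists i; rewrite //= inE.
Qed.

(** The matched pair becomes [sync i], which the inner hiding erases; what is left has the labels of
    [act i], in the first part of the allow set. *)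
Lemma encapsulate_sync (i : idx P) v w sigma : w = mact_eval sigma (act i) ->
  let w' := gamma comms (w `+` ([mset (syncV i, v)] `+` [mset (syncW i, v)])) in
  labels (theta syncs w') \in allowed /\
  theta [fset tg] (theta syncs w') = mact_eval sigma (act i).
Proof.
move=> ->; have fw := fresh_act sigma i.
rewrite /= gamma_comms_sync// thetaD (fresh_theta fw syncs_new) theta1; last first.
  by apply/imfsetP; exists i.
rewrite msetD0; split; last exact: fresh_theta fw tg_new.
rewrite labels_mact_eval in_fsetU; apply/orP; left.
by apply/imfsetP; exists i.
Qed.

(** One added action cannot be a redex, which takes two distinct reserved labels. Communication is
    thus idle and a component label would reach the allow set. Hence a component moving alone makes
    a tagged step. *)
Lemma single_allowed w x : is_fresh w ->
  labels (theta syncs (gamma comms (w `+` [mset x]))) \in allowed ->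
  (forall i, x.1 <> syncV i) /\ (forall i, x.1 <> syncW i).
Proof.
have [[_ _ [VW _ _]] _] := new_distinct.
case: x => l v fw; rewrite gamma_comms_id => [/allowed_theta[aV aW _]|i u].
  by split=> i eq_l; [have := aV i v | have := aW i v];
     rewrite -eq_l in_msetD in_mset1 /= eqxx orbT.
rewrite !in_msetD !(mem_fresh _ fw (new_syncV _), mem_fresh _ fw (new_syncW _)).
rewrite !in_mset1 !xpair_eqE /= => /andP[/eqP <- _] /andP[/eqP eqVW _].
exact: VW (esym eqVW).
Qed.

(** Unless [x] and [y] form a redex, communication is idle, and a component label or two tags reach
    the allow set. *)
Lemma pair_allowed w1 w2 x y : is_fresh w1 -> is_fresh w2 ->
  x.1 = tg \/ (exists i, x.1 = syncV i) ->
  y.1 = tg \/ (exists i, y.1 = syncW i) ->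
  labels (theta syncs (gamma comms ((w1 `+` [mset x]) `+` (w2 `+` [mset y]))))
    \in allowed ->
  exists i, [/\ x.1 = syncV i, y.1 = syncW i & x.2 = y.2].
Proof.
have [[_ _ [VW _ _]] [tV tW _]] := new_distinct.
case: x y => [lx vx] [ly vy] /= f1 f2 lxP lyP.
have [/existsP[i /and3P[/eqP-> /eqP-> /eqP->]]|] :=
  boolP [exists i, [&& lx == syncV i, ly == syncW i & vx == vy]].
  by exists i.
move=> /existsPn noredex; rewrite gamma_comms_id => [/allowed_theta[aV aW]|i u].
  case: lxP => [->|[i eq_l]]; last first.
    by have := aV i vx; rewrite eq_l !in_msetD !in_mset1 eqxx !orbT.
  case: lyP => [->|[i eq_l]]; last first.
    by have := aW i vy; rewrite eq_l !in_msetD !in_mset1 eqxx !orbT.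
  by rewrite !labelsD !labels1 !msetE2 !msetnxx addnACA addnC ltnNge.
rewrite !in_msetD.
rewrite !(mem_fresh _ f1 (new_syncV _), mem_fresh _ f1 (new_syncW _)).
rewrite !(mem_fresh _ f2 (new_syncV _), mem_fresh _ f2 (new_syncW _)).
rewrite !in_mset1 !xpair_eqE /=.
(* Distinctness of the reserved labels forces the [syncV] half of a redex to be [x] and the [syncW]
   half to be [y], a case already excluded. *)
move=> /orP[]/andP[/eqP eqV /eqP eqv]; last first.
  case: lyP => [/(etrans eqV)/tV//|[j /(etrans eqV)/VW//]].
move=> /orP[]/andP[/eqP eqW /eqP eqv'].
  case: lxP => [/(etrans eqW)/tW//|[j /(etrans eqW)/esym/VW//]].
by have := noredex i; rewrite -eqV -eqW -eqv -eqv' !eqxx.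
Qed.

Lemma ind_act_fresh (X : sep_tuple P) (syn : idx P -> L) sigma (i : idx P) :
  (forall a, a \in new -> forall j, j \in sep_J X :\: sep_K X ->
     a \notin mact_labels (sep_a X j)) ->
  i \in sep_J X ->
  exists2 w, is_fresh w & exists x,
    ind_act X syn tg sigma i = w `+` [mset x] /\
    (x.1 = if i \in sep_K X then tg else syn i).
Proof.
move=> frX iJ; rewrite /ind_act; case: ifP => iK.
  by exists (mact_eval sigma (act i)); [apply: fresh_act | exists (tg, [::])].
exists (mact_eval sigma (sep_a X i)); last by eexists; split.
by move=> a a_new; rewrite labels_mact_eval frX// inE iK.
Qed.

Lemma fresh_sepV a : a \in new -> forall i, i \in sep_J V :\: sep_K V ->
  a \notin mact_labels (sep_a V i).
Proof. by case: fresh => _ fr _ _ _ /fr[]. Qed.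

Lemma fresh_sepW a : a \in new -> forall i, i \in sep_J W :\: sep_K W ->
  a \notin mact_labels (sep_a W i).
Proof. by case: fresh => _ fr _ _ _ /fr[]. Qed.

Lemma ind_actV_allowed sigma (i : idx P) : i \in sep_J V ->
  labels (theta syncs (gamma comms (ind_act V syncV tg sigma i))) \in allowed ->
  i \in sep_K V.
Proof.
move=> /(ind_act_fresh syncV sigma fresh_sepV)[w fw [x [-> def_x]]].
move=> /(single_allowed fw)[/(_ i)+ _].
by rewrite def_x; case: ifP.
Qed.

Lemma ind_actW_allowed sigma (i : idx P) : i \in sep_J W ->
  labels (theta syncs (gamma comms (ind_act W syncW tg sigma i))) \in allowed ->
  i \in sep_K W.
Proof.
move=> /(ind_act_fresh syncW sigma fresh_sepW)[w fw [x [-> def_x]]].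
move=> /(single_allowed fw)[_ /(_ i)].
by rewrite def_x; case: ifP.
Qed.

Lemma ind_act_pair_allowed sigma sigma' (i j : idx P) :
  i \in sep_J V -> j \in sep_J W ->
  labels (theta syncs (gamma comms
    (ind_act V syncV tg sigma i `+` ind_act W syncW tg sigma' j))) \in allowed ->
  [/\ i = j, i \notin sep_K V, j \notin sep_K W &
      args_eval sigma (sep_h V i) = args_eval sigma' (sep_h W j)].
Proof.
have [[inV inW _] [tV tW _]] := new_distinct.
have fw sg (k : idx P) := fresh_act sg k.
have fV sg (k : idx P) : k \in sep_J V -> k \notin sep_K V ->
    is_fresh (mact_eval sg (sep_a V k)).
  by move=> kJ kK a a_new; rewrite labels_mact_eval fresh_sepV// inE kK.
have fW sg (k : idx P) : k \in sep_J W -> k \notin sep_K W ->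
    is_fresh (mact_eval sg (sep_a W k)).
  by move=> kJ kK a a_new; rewrite labels_mact_eval fresh_sepW// inE kK.
move=> iJ jJ; rewrite /ind_act.
(* Any case with a tag would equate the tag with a component label. In the remaining case,
   injectivity of [syncV] and [syncW] identifies both indices with that of the redex. *)
case: ifPn => iK; case: ifPn => jK /pair_allowed [];
  do ?[exact: fw | exact: fV | exact: fW | by left | by right; eexists].
- by move=> k [/esym/tV].
- by move=> k [/esym/tV].
- by move=> k [_ /esym/tW].
- by move=> k [/inV -> /inW -> /= eq_h].
Qed.

(** A summand in [K] reads only the parameters in [U] and its sum variables, so [P] can take it from
    [t] whatever [sigma] assigns to the other parameters. *)
Lemma K_step (X : sep_tuple P) (i : idx P) sigma (t : vec (prm P))
    (tX : vec (restr_prm (prm P) (U:=sep_U X))) :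
  lpe_wf D P -> is_sep_tuple D X -> i \in sep_K X ->
  (forall k, sigma (prm P (val k)) = tX k) ->
  (forall k, eval (tX k) = eval (t (val k))) ->
  holds sigma (cond i) ->
  exists2 t' : vec (prm P), lpe_step t (mact_eval sigma (act i)) t' &
    (forall k : 'I_n.+1, sep_U X k ->
       eval (t' k) = eval (app sigma (Defs.next i k))) /\
    (forall k, Defs.next i k = evar (prm P k) -> t' k = t k).
Proof.
move=> wfP [_ _ /(_ i) sepX] /sepX[sub_c sub_a sub_n] EX Et ci.
have E : agree_on (scope_vars (fun k : 'I_n.+1 => sep_U X k) i)
    (bind t sigma) sigma.
  apply: bind_agree_scope wfP _ => k Uk.
  by rewrite -[k]/(val (Sub k Uk : idx_in n (sep_U X))) EX Et.
exists (fun k => app (bind t sigma) (Defs.next i k)); last split.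
- exists i, (bind t sigma); split=> //.
  + by move=> k; rewrite bind_in//; case: wfP.
  + by rewrite (holds_agree sub_c E).
  + by rewrite (mact_eval_agree sub_a E).
- by move=> k Uk; apply: same_value_agree (sub_n k Uk) E.
- by move=> k ->; rewrite app_evar bind_in//; case: wfP.
Qed.

End Composition.

(** * The bisimulation *)

Theorem theorem2 (T : data_theory) (L : choiceType) (D : L -> seq (dsort T))
    (n : nat) (P : lpe T L 'I_n.+1) (V W : sep_tuple P)
    (syncV syncW sync : idx P -> L) (tg : L) (psi : expr (bsort T)) :
  lpe_wf D P ->
  is_sep_tuple D V ->
  is_sep_tuple D W ->
  cleave V W ->
  (* The components together keep all parameters; implicit in the notion of
     cleave, and bisimilarity fails without it. *)
  (forall k : 'I_n.+1, sep_U V k || sep_U W k) ->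
  fresh_labels D V W syncV syncW sync tg ->
  state_invariant P psi ->
  forall iota : vec (prm P),
    holds (subst1 iota) psi ->
    let C := (sep_J V :&: sep_J W)%SET in
    let PV := induced_psi V syncV tg psi C in
    let PW := induced_psi W syncW tg psi C in
    let comms : {fset comm L} :=
      [fset ([mset syncV i; syncW i], sync i) | i in idx P] in
    let allowed : {fset {mset L}} :=
      [fset mact_labels (act i) | i in idx P] `|`
      [fset mact_labels (Bar (act i) (Act tg [::])) | i in (sep_K V :|: sep_K W)%SET] in
    bisimilar
      (proc_lts
        (PHide [fset tg]
          (PAllow allowed
            (PHide [fset sync i | i in idx P]
              (PComm comms
                (PPar (@PCall T L _ PV (restr iota))
                      (@PCall T L _ PW (restr iota))))))))
      (lpe_lts iota).
Proof.
move=> wfP sepV sepW [[JV JW] [keepW keepV] cl3 cl4] cover fresh inv iota psi0.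
move=> C PV PW comms allowed.
have [inj_prm _] := wfP; have [sub_psi _] := inv.
pose par tV tW := PPar (@PCall T L _ PV tV) (@PCall T L _ PW tW).
(* The truth of [psi] is recorded because the strengthened summands must be enabled when [P] moves
   first. *)
pose related (tV : vec (prm PV)) (tW : vec (prm PW)) (t : vec (prm P)) :=
  [/\ forall k, eval (tV k) = eval (t (val k)),
      forall k, eval (tW k) = eval (t (val k)) & holds (subst1 t) psi].
exists (fun S t => exists tV tW,
  S = encapsulate V W syncV syncW sync tg (par tV tW) /\ related tV tW t).
split; first by exists (restr iota), (restr iota).
(* By condition (1), [C] is disjoint from [K^V] and [K^W], so tagged summands keep their original
   conditions. *)
have C_K i : i \in C -> i \notin sep_K V /\ i \notin sep_K W.
  by rewrite inE JV JW !inE => /andP[].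
have K_C (i : idx P) : (i \in sep_K V) || (i \in sep_K W) -> (i \in C) = false.
  by move=> iK; apply: contraTF iK => /C_K[] /negbTE -> /negbTE ->.
have ci_ind X i sigma : (i \in sep_K V) || (i \in sep_K W) -> i \in sep_K X ->
    ind_cond X psi C sigma i = holds sigma (cond i).
  by move=> iK iX; rewrite /ind_cond iX K_C// andbT.
have ai_ind X syn i sigma : i \in sep_K X ->
    ind_act X syn tg sigma i =
    (mact_eval sigma (act i) `+` [mset (tg, [::])])%mset.
  by rewrite /ind_act => ->.
have KJV i : i \in sep_K V -> i \in sep_J V.
  by case: sepV => /subsetP + _ _; apply.
have KJW i : i \in sep_K W -> i \in sep_J W.
  by case: sepW => /subsetP + _ _; apply.
move=> _ t [tV [tW [-> [EV EW psi_t]]]]; split=> w.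
  (* The composition moves: the first component alone, the second alone, or both. *)
  move=> S' /encapsulate_step_inv[w1 [S1 [st al -> ->]]].
  case: (proc_step_inv st) al => {st} [[S2 st ->]|[S2 st ->]|].
  - have [tV' st' ->] := proc_step_inv st.
    have [i [sigma [iJ Es ci -> Et']] al] := induced_step_inv st'.
    have iK := ind_actV_allowed fresh iJ al.
    have iKK : (i \in sep_K V) || (i \in sep_K W) by rewrite iK.
    move: ci; rewrite ci_ind// => ci.
    have [t' stP [EV' keep]] := K_step wfP sepV iK Es EV ci.
    have [_ eq_act] := encapsulate_tagged fresh sigma iKK.
    rewrite ai_ind// eq_act; exists t' => //; exists tV', tW; split=> //; split.
    + by move=> k; rewrite EV' ?Et'//; apply: valP k.
    + by move=> k; rewrite EW keep// keepW//; apply: valP k.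
    + exact: invariant_step wfP inv stP psi_t.
  - have [tW' st' ->] := proc_step_inv st.
    have [i [sigma [iJ Es ci -> Et']] al] := induced_step_inv st'.
    have iK := ind_actW_allowed fresh iJ al.
    have iKK : (i \in sep_K V) || (i \in sep_K W) by rewrite iK orbT.
    move: ci; rewrite ci_ind// => ci.
    have [t' stP [EW' keep]] := K_step wfP sepW iK Es EW ci.
    have [_ eq_act] := encapsulate_tagged fresh sigma iKK.
    rewrite ai_ind// eq_act; exists t' => //; exists tV, tW'; split=> //; split.
    + by move=> k; rewrite EV keep// keepV//; apply: valP k.
    + by move=> k; rewrite EW' ?Et'//; apply: valP k.
    + exact: invariant_step wfP inv stP psi_t.
  - move=> [wV [wW [S2 [S3 [stV stW -> ->]]]]].
    have [tV' stV' ->] := proc_step_inv stV.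
    have [tW' stW' ->] := proc_step_inv stW.
    have [i [sigma [iJ EsV ci -> EtV]]] := induced_step_inv stV'.
    have [j [sigma' [jJ EsW cj -> EtW]] al] := induced_step_inv stW'.
    have [eq_ij iK jK eq_h] := ind_act_pair_allowed fresh iJ jJ al.
    move: eq_ij jJ cj EtW jK eq_h {al} => <- jJ cj EtW jK eq_h.
    have iC : i \in C by rewrite inE iJ.
    move: ci cj; rewrite /ind_cond (negbTE iK) (negbTE jK).
    move=> /andP[ci _] /andP[cj _].
    have [rho [rhoV rhoW c_rho eq_act [nextV nextW]]] := cl4 _ _ _ iC ci cj eq_h.
    (* Condition (4) fixes the values of [rho] on [V] and on [W]; as these cover all parameters,
       [rho] describes the state [t]. *)
    have E k : eval (t k) = eval (rho (prm P k)).
      have /orP[Uk|Uk] := cover k.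
        rewrite -[k]/(val (Sub k Uk : idx_in n (sep_U V))) -EV -EsV.
        by have := rhoV k Uk; rewrite /same_value !app_evar.
      rewrite -[k]/(val (Sub k Uk : idx_in n (sep_U W))) -EW -EsW.
      by have := rhoW k Uk; rewrite /same_value !app_evar.
    have [t' stP Et'] := lpe_step_intro inj_prm E c_rho.
    (* Equal data vectors and regrouping bring the two component labels together as one redex. *)
    rewrite /ind_act (negbTE iK) (negbTE jK) -eq_h msetDACA.
    have [_ ->] := encapsulate_sync fresh (args_eval sigma (sep_h V i)) eq_act.
    exists t' => //; exists tV', tW'; split=> //; split.
    + by move=> k; rewrite EtV Et'; apply: nextV; apply: valP k.
    + by move=> k; rewrite EtW Et'; apply: nextW; apply: valP k.
    + exact: invariant_step wfP inv stP psi_t.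
(* Now [P] moves with summand [i]; the cases are [i] in [K^V], in [K^W], or in neither. *)
move=> t' stP; have psi_t' := invariant_step wfP inv stP psi_t.
have [i [sigma [Es ci def_w Et']]] := stP.
have keep k : Defs.next i k = evar (prm P k) -> t' k = t k.
  by move=> nk; rewrite Et' nk app_evar Es.
have EsV k : eval (tV k) = eval (sigma (prm P (val k))) by rewrite EV Es.
have EsW k : eval (tW k) = eval (sigma (prm P (val k))) by rewrite EW Es.
have [iKV|iNKV] := boolP (i \in sep_K V).
  have iKK : (i \in sep_K V) || (i \in sep_K W) by rewrite iKV.
  have cV : ind_cond V psi C sigma i by rewrite ci_ind.
  have [tV' stV EV'] :=
    induced_step_intro syncV tg inj_prm (KJV _ iKV) EsV cV.
  have [al eq_act] := encapsulate_tagged fresh sigma iKK.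
  exists (encapsulate V W syncV syncW sync tg (par tV' tW)).
    rewrite def_w -eq_act; apply: encapsulate_step al.
    by rewrite ai_ind// in stV; apply/step_parl/step_call.
  exists tV', tW; split=> //; split=> // k; first by rewrite EV' Et'.
  by rewrite EW keep// keepW//; apply: valP k.
have [iKW|iNKW] := boolP (i \in sep_K W).
  have iKK : (i \in sep_K V) || (i \in sep_K W) by rewrite iKW orbT.
  have cW : ind_cond W psi C sigma i by rewrite ci_ind.
  have [tW' stW EW'] :=
    induced_step_intro syncW tg inj_prm (KJW _ iKW) EsW cW.
  have [al eq_act] := encapsulate_tagged fresh sigma iKK.
  exists (encapsulate V W syncV syncW sync tg (par tV tW')).
    rewrite def_w -eq_act; apply: encapsulate_step al.
    by rewrite ai_ind// in stW; apply/step_parr/step_call.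
  exists tV, tW'; split=> //; split=> // k; last by rewrite EW' Et'.
  by rewrite EV keep// keepV//; apply: valP k.
(* Outside both [K^V] and [K^W], condition (1) puts [i] in [C], so both components synchronise under
   the same [sigma]. *)
have iJV : i \in sep_J V by rewrite JV inE.
have iJW : i \in sep_J W by rewrite JW inE.
have iC : i \in C by rewrite inE iJV.
have [cV cW eq_h eq_a] := cl3 _ _ iC ci.
have psi_s : holds sigma psi.
  by rewrite (holds_subst1 inj_prm sub_psi (t := t))// => k; rewrite Es.
have cV' : ind_cond V psi C sigma i.
  by rewrite /ind_cond (negbTE iNKV) cV psi_s implybT.
have cW' : ind_cond W psi C sigma i.
  by rewrite /ind_cond (negbTE iNKW) cW psi_s implybT.
have [tV' stV EV'] := induced_step_intro syncV tg inj_prm iJV EsV cV'.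
have [tW' stW EW'] := induced_step_intro syncW tg inj_prm iJW EsW cW'.
have [al eq_act] := encapsulate_sync fresh (args_eval sigma (sep_h V i)) eq_a.
exists (encapsulate V W syncV syncW sync tg (par tV' tW')).
  rewrite def_w -eq_act; apply: encapsulate_step al; rewrite msetDACA.
  move: stV stW; rewrite /ind_act (negbTE iNKV) (negbTE iNKW) -eq_h => stV stW.
  by apply: step_par; apply: step_call.
by exists tV', tW'; split=> //; split=> // k; rewrite ?EV' ?EW' Et'.
Qed.
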